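(* Let $\tau>0$ and let $f\colon\mathbb{R}\to\mathbb{R}$ be a function of bounded variation (on each compact interval), continuous from the right, which is either constant or periodic with minimal period $\tau$. Let $U\colon Y\to Y$ be the monodromy operator of $x(t)=f(t)x(t-\tau)$ and let $U_{\mathbb{C}}\colon Y_{\mathbb{C}}\to Y_{\mathbb{C}}$ be its complexification. Then the residual spectrum of $U_{\mathbb{C}}$ is $$\sigma_r(U_{\mathbb{C}})=\overline{f(\mathbb{R})}\setminus\{\lambda\in\mathbb{C}\mid (f^{-1}(\lambda))^{\circ}\neq\emptyset\}.$$
   Context: $Y:=NBV([-\tau,0];\mathbb{R})$ is the Banach space, with the total variation norm, of functions $\phi\colon[-\tau,0]\to\mathbb{R}$ of bounded variation that are continuous from the right and satisfy $\phi(0)=0$. Its complexification is $Y_{\mathbb{C}}\cong NBV([-\tau,0];\mathbb{C})$ (the same with complex values, total variation norm). For a function $x$ the segment of $x$ at $t$ is $x_t(\theta):=x(t+\theta)$, $\theta\in[-\tau,0]$. For $\phi\in Y$, let $x(\cdot;\phi)$ be the unique solution of the initial value problem $x(t)=f(t)x(t-\tau)$ for $t\ge 0$, $x_0=\phi$. The monodromy operator is $U\phi:=x_\tau(\cdot;\phi)$. Convention on the normalization at $0$: the initial condition prescribes $x(\theta)=\phi(\theta)$ for $\theta\in[-\tau,0)$, the equation prescribes $x(t)$ for $t\ge 0$, and segments are regarded as elements of $Y$ by assigning them the value $0$ at $\theta=0$; so $(U\phi)(\theta)=x(\tau+\theta;\phi)$ for $\theta\in[-\tau,0)$ and $(U\phi)(0)=0$.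 The complexified operator is $U_{\mathbb{C}}(\phi_{\Re}+\mathrm{i}\phi_{\Im}):=U\phi_{\Re}+\mathrm{i}U\phi_{\Im}$ for $\phi_{\Re},\phi_{\Im}\in Y$. The residual spectrum is $\sigma_r(U_{\mathbb{C}})=\sigma(U_{\mathbb{C}})\setminus(\sigma_p(U_{\mathbb{C}})\cup\sigma_c(U_{\mathbb{C}}))$, where $\sigma$ is the spectrum, $\sigma_p$ is the set of $\lambda\in\mathbb{C}$ for which $U_{\mathbb{C}}-\lambda I_{Y_{\mathbb{C}}}$ is not injective, and $\sigma_c$ is the set of $\lambda\in\mathbb{C}$ for which $U_{\mathbb{C}}-\lambda I_{Y_{\mathbb{C}}}$ is injective and not surjective but has dense range. $f^{-1}(\lambda)=\{t\in\mathbb{R}\mid f(t)=\lambda\}$ and $S^{\circ}$ denotes the interior of $S\subset\mathbb{R}$ in $\mathbb{R}$. *)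

(* Defs.v *)
(* MathComp-Analysis over an arbitrary R : realType; C is R[i]. *)
From HB Require Import structures.
From mathcomp Require Import all_boot all_order all_algebra.
From mathcomp Require Import all_classical all_reals all_analysis.
From mathcomp Require Import complex ring lra.

Set Implicit Arguments.
Unset Strict Implicit.
Unset Printing Implicit Defensive.

Import Order.TTheory GRing.Theory Num.Theory.
Import ComplexField.Normc.
Import numFieldNormedType.Exports.

Local Open Scope classical_set_scope.
Local Open Scope ring_scope.
Local Open Scope complex_scope.

(* R[i] carries the topology of its modulus. *)
HB.instance Definition _ (R : realType) := NormedModule.copy R[i] R[i]^o.

Section Variation.
Context {R : realType} {V : normedZmodType R}.
Implicit Types (a b : R) (f g h : R -> V) (s : seq R).

(* The library's [variation], [variations] and [bounded_variation] are stated
   for real-valued functions only. For V := R the notions below are convertible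
   to them; for V := Rcomplex R, which is R[i] with its R-valued modulus, they
   are the complex ones. *)
Definition vvariation a b f s : R := let F := f \o nth b (a :: s) in
  \sum_(0 <= n < size s) `|F n.+1 - F n|.

Definition vvariations a b f : set R :=
  [set vvariation a b f s | s in itv_partition a b].

Definition vbounded_variation a b f := has_ubound (vvariations a b f).

(* Equals 0 by convention if b < a or if f is not of bounded variation. *)
Definition vtotal_variation a b f : R := sup (vvariations a b f).

Lemma vvariation_ge0 a b f s : 0 <= vvariation a b f s.
Proof. exact: sumr_ge0. Qed.

Lemma vvariation_le a b f s :
  vbounded_variation a b f -> itv_partition a b s ->
  vvariation a b f s <= vtotal_variation a b f.
Proof. by move=> bvf ps; apply: ub_le_sup => //; exists s. Qed.

Lemma vtotal_variation_ge0 a b f : 0 <= vtotal_variation a b f.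
Proof.
rewrite /vtotal_variation; have [hs|/sup_out->//] := pselect (has_sup (vvariations a b f)).
have [[x xf] ub] := hs; apply: (le_trans _ (ub_le_sup ub xf)).
by case: xf => s _ <-; exact: vvariation_ge0.
Qed.

Lemma vtotal_variation_le a b f (M : R) : 0 <= M ->
  (forall s, itv_partition a b s -> vvariation a b f s <= M) ->
  vtotal_variation a b f <= M.
Proof.
move=> M0 fM; rewrite /vtotal_variation.
have [->|/set0P ne] := eqVneq (vvariations a b f) set0; first by rewrite sup0.
by apply: ge_sup => // _ [s ps <-]; exact: fM.
Qed.

Lemma le_vtotal_variation a b f x : a <= x <= b -> f b = 0 ->
  vbounded_variation a b f -> `|f x| <= vtotal_variation a b f.
Proof.
move=> /andP[ax]; rewrite le_eqVlt => /predU1P[->|xb] fb bvf.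
  by rewrite fb normr0 vtotal_variation_ge0.
move: ax; rewrite le_eqVlt => /predU1P[ax|ax].
  have p : itv_partition a b [:: b] by apply: itv_partition1; rewrite ax.
  apply: le_trans (vvariation_le bvf p).
  by rewrite /vvariation big_nat1 /= fb sub0r normrN ax.
have p : itv_partition a b [:: x; b] by split => //=; rewrite ax xb.
apply: le_trans (vvariation_le bvf p).
by rewrite /vvariation big_nat_recr //= big_nat1 /= fb sub0r normrN lerDr.
Qed.

End Variation.

Section VariationBound.
Context {R : realType} {U V W : normedZmodType R} (a b : R).
Variables (f : R -> U) (g : R -> V) (h : R -> W) (c d : R).
Hypotheses (c0 : 0 <= c) (d0 : 0 <= d).
Hypothesis hfg : forall x y, a <= x <= b -> a <= y <= b ->
  `|h x - h y| <= c * `|f x - f y| + d * `|g x - g y|.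
Hypothesis bvf : vbounded_variation a b f.
Hypothesis bvg : vbounded_variation a b g.

Let vvariation_bound s : itv_partition a b s ->
  vvariation a b h s
    <= c * vtotal_variation a b f + d * vtotal_variation a b g.
Proof.
move=> ps.
apply: (@le_trans _ _ (c * vvariation a b f s + d * vvariation a b g s)); last first.
  by rewrite lerD// ler_wpM2l// vvariation_le.
rewrite /vvariation !mulr_sumr -big_split /= !big_nat; apply: ler_sum => n /= ns.
have in_ab m : (m < (size s).+1)%N -> a <= nth b (a :: s) m <= b.
  by move=> ms; rewrite (itv_partition_nth_ge ms ps) (itv_partition_nth_le ms ps).
by apply: hfg; [exact: (in_ab n.+1)|apply: in_ab; rewrite ltnS ltnW].
Qed.

Lemma vbounded_variation2 : vbounded_variation a b h.
Proof. by eexists => _ [s ps <-]; exact: vvariation_bound. Qed.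

Lemma vtotal_variation2 : vtotal_variation a b h
  <= c * vtotal_variation a b f + d * vtotal_variation a b g.
Proof.
apply: vtotal_variation_le => //.
by rewrite addr_ge0 // mulr_ge0 // vtotal_variation_ge0.
Qed.

End VariationBound.

Lemma vtotal_variation_scale {R : realType} {V W : normedZmodType R} (a b : R)
    (f : R -> V) (h : R -> W) (c : R) : 0 <= c ->
  (forall x y, `|h x - h y| = c * `|f x - f y|) ->
  vbounded_variation a b f ->
  vtotal_variation a b h = c * vtotal_variation a b f.
Proof.
move=> c0 hf bvf.
have hle x y : a <= x <= b -> a <= y <= b ->
  `|h x - h y| <= c * `|f x - f y| + 0 * `|f x - f y|.
  by rewrite mul0r addr0 hf.
have bvh := vbounded_variation2 c0 (lexx 0) hle bvf bvf.
have := vtotal_variation2 c0 (lexx 0) hle bvf bvf.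
rewrite mul0r addr0 => le1; apply: le_anti; rewrite le1 /=.
have [c00|cN0] := eqVneq c 0; first by rewrite c00 mul0r vtotal_variation_ge0.
have {}c0 : 0 < c by rewrite lt_neqAle eq_sym cN0.
rewrite mulrC -ler_pdivlMr// mulrC.
have ci0 : 0 <= c^-1 by rewrite invr_ge0 ltW.
have hle' x y : a <= x <= b -> a <= y <= b ->
  `|f x - f y| <= c^-1 * `|h x - h y| + 0 * `|h x - h y|.
  by rewrite mul0r addr0 hf mulKf ?gt_eqF.
by have := vtotal_variation2 ci0 (lexx 0) hle' bvh bvh; rewrite mul0r addr0.
Qed.

Section RealNBV.
Context {R : realType}.
Implicit Types (tau : R) (phi : R -> R).

(* A function on [-tau, 0] is represented by its extension by 0 to R. *)
Definition is_nbv tau phi := [/\ bounded_variation (- tau) 0 phi,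
  forall t : R, - tau <= t < 0 -> phi x @[x --> t^'+] --> phi t,
  phi 0 = 0 &
  forall t : R, ~~ (- tau <= t <= 0) -> phi t = 0].

Definition nbv tau : {pred R -> R} := mem [set phi | is_nbv tau phi].

Lemma nbvP tau phi : reflect (is_nbv tau phi) (phi \in nbv tau).
Proof. by apply: (iffP idP) => [/set_mem|h]; [|apply: mem_set]. Qed.

Lemma nbv_submod_closed tau : submod_closed (nbv tau).
Proof.
split=> [|a phi psi /nbvP[bp rp p0 pN] /nbvP[bq rq q0 qN]]; apply/nbvP; split.
- exists 0 => _ [s _ <-]; rewrite /variation big1// => n _.
  by rewrite /= subrr normr0.
- by move=> t _; exact: cvg_cst.
- by [].
- by [].
- apply: (@vbounded_variation2 R R R R _ _ phi psi _ `|a| 1) => // x y _ _.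
  rewrite !fctE mul1r -normrM (le_trans _ (ler_normD _ _))//.
  by rewrite le_eqVlt; apply/orP; left; apply/eqP; congr `|_|; rewrite /GRing.scale/=; ring.
- by move=> t tt; apply: cvgD; [apply: cvgZr; exact: rp|exact: rq].
- by rewrite !fctE p0 q0 scaler0 addr0.
- by move=> t tt; rewrite !fctE pN// qN// scaler0 addr0.
Qed.

HB.instance Definition _ tau :=
  GRing.isSubmodClosed.Build _ _ (nbv tau) (@nbv_submod_closed tau).

Record NBV tau := MkNBV { nbv_fun :> R -> R ; _ : nbv_fun \in nbv tau }.

HB.instance Definition _ tau := [isSub for @nbv_fun tau].
HB.instance Definition _ tau := [Choice of NBV tau by <:].
HB.instance Definition _ tau := [SubChoice_isSubLmodule of NBV tau by <:].

Lemma NBV_is_nbv tau (phi : NBV tau) : is_nbv tau phi.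
Proof. by case: phi => phi /= /nbvP. Qed.

Lemma NBV_addE tau (phi psi : NBV tau) x : (phi + psi) x = phi x + psi x.
Proof. by []. Qed.

Lemma NBV_scaleE tau (a : R) (phi : NBV tau) x : (a *: phi) x = a * phi x.
Proof. by []. Qed.

Definition NBV_norm tau (phi : NBV tau) : R := vtotal_variation (- tau) 0 phi.

Lemma NBV_normD tau (phi psi : NBV tau) :
  NBV_norm (phi + psi) <= NBV_norm phi + NBV_norm psi.
Proof.
have [bp _ _ _] := NBV_is_nbv phi; have [bq _ _ _] := NBV_is_nbv psi.
rewrite -[leRHS]mul1r mulrDr.
apply: (@vtotal_variation2 R R R R _ _ phi psi _ 1 1) => // x y _ _.
rewrite !mul1r; apply: le_trans (ler_normD _ _).
by rewrite le_eqVlt; apply/orP; left; apply/eqP; congr `|_|; rewrite !NBV_addE; ring.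
Qed.

Lemma NBV_normZ tau (a : R) (phi : NBV tau) :
  NBV_norm (a *: phi) = `|a| * NBV_norm phi.
Proof.
have [bp _ _ _] := NBV_is_nbv phi.
apply: (@vtotal_variation_scale R R R) => // x y.
by rewrite -normrM !NBV_scaleE mulrBr.
Qed.

Lemma NBV_norm_eq0 tau (phi : NBV tau) : NBV_norm phi = 0 -> phi = 0.
Proof.
have [bp _ p0 pN] := NBV_is_nbv phi => tv0.
apply/val_inj/funext => x /=; have [xI|xI] := boolP (- tau <= x <= 0).
  apply/eqP; rewrite -normr_le0 -tv0.
  exact: (@le_vtotal_variation R R).
exact: pN.
Qed.

HB.instance Definition _ tau := Lmodule_isNormed.Build R (NBV tau)
  (@NBV_normD tau) (@NBV_normZ tau) (@NBV_norm_eq0 tau).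

End RealNBV.

Section ComplexNBV.
Context {R : realType}.
Implicit Types (tau : R) (phi : R -> R[i]).

Definition is_nbvC tau phi := [/\ vbounded_variation (V := Rcomplex R) (- tau) 0 phi,
  forall t : R, - tau <= t < 0 -> phi x @[x --> t^'+] --> phi t,
  phi 0 = 0 &
  forall t : R, ~~ (- tau <= t <= 0) -> phi t = 0].

Definition nbvC tau : {pred R -> R[i]} := mem [set phi | is_nbvC tau phi].

Lemma nbvCP tau phi : reflect (is_nbvC tau phi) (phi \in nbvC tau).
Proof. by apply: (iffP idP) => [/set_mem|h]; [|apply: mem_set]. Qed.

Lemma nbvC_submod_closed tau : submod_closed (nbvC tau).
Proof.
split=> [|a phi psi /nbvCP[bp rp p0 pN] /nbvCP[bq rq q0 qN]]; apply/nbvCP; split.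
- exists 0 => _ [s _ <-]; rewrite /vvariation big1// => n _.
  by rewrite /= subrr normr0.
- by move=> t _; exact: cvg_cst.
- by [].
- by [].
- apply: (@vbounded_variation2 R (Rcomplex R) (Rcomplex R) (Rcomplex R) _ _
    phi psi _ (normc a) 1) => // [|x y _ _].
    exact: (normr_ge0 (a : Rcomplex R)).
  rewrite mul1r -[normc a * _]normcM.
  apply: le_trans (le_normcD _ _).
  rewrite le_eqVlt; apply/orP; left; apply/eqP; congr normc.
  by rewrite !fctE /GRing.scale /=; ring.
- by move=> t tt; apply: cvgD; [apply: cvgZr; exact: rp|exact: rq].
- by rewrite !fctE p0 q0 scaler0 addr0.
- by move=> t tt; rewrite !fctE pN// qN// scaler0 addr0.
Qed.

HB.instance Definition _ tau :=
  GRing.isSubmodClosed.Build _ _ (nbvC tau) (@nbvC_submod_closed tau).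

Record NBVC tau := MkNBVC { nbvC_fun :> R -> R[i] ; _ : nbvC_fun \in nbvC tau }.

HB.instance Definition _ tau := [isSub for @nbvC_fun tau].
HB.instance Definition _ tau := [Choice of NBVC tau by <:].
HB.instance Definition _ tau := [SubChoice_isSubLmodule of NBVC tau by <:].

Lemma NBVC_is_nbvC tau (phi : NBVC tau) : is_nbvC tau phi.
Proof. by case: phi => phi /= /nbvCP. Qed.

(* Norms of a normed module over R[i] are R[i]-valued. *)
Lemma NBVC_addE tau (phi psi : NBVC tau) x : (phi + psi) x = phi x + psi x.
Proof. by []. Qed.

Lemma NBVC_scaleE tau (a : R[i]) (phi : NBVC tau) x : (a *: phi) x = a * phi x.
Proof. by []. Qed.

Definition NBVC_norm tau (phi : NBVC tau) : R[i] :=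
  (vtotal_variation (V := Rcomplex R) (- tau) 0 phi)%:C.

Lemma NBVC_normD tau (phi psi : NBVC tau) :
  NBVC_norm (phi + psi) <= NBVC_norm phi + NBVC_norm psi.
Proof.
have [bp _ _ _] := NBVC_is_nbvC phi; have [bq _ _ _] := NBVC_is_nbvC psi.
rewrite /NBVC_norm -rmorphD /= lecR -[leRHS]mul1r mulrDr.
apply: (@vtotal_variation2 R (Rcomplex R) (Rcomplex R) (Rcomplex R) _ _
  phi psi _ 1 1) => // x y _ _.
rewrite !mul1r; apply: le_trans (le_normcD _ _).
rewrite le_eqVlt; apply/orP; left; apply/eqP; congr normc.
transitivity ((phi x + psi x : R[i]) - (phi y + psi y)) => //.
by ring.
Qed.

Lemma NBVC_normZ tau (a : R[i]) (phi : NBVC tau) :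
  NBVC_norm (a *: phi) = `|a| * NBVC_norm phi.
Proof.
have [bp _ _ _] := NBVC_is_nbvC phi.
rewrite /NBVC_norm -[`|a|]/((normc a)%:C) -rmorphM /=; congr (_%:C).
apply: (@vtotal_variation_scale R (Rcomplex R) (Rcomplex R)) => //.
  exact: (normr_ge0 (a : Rcomplex R)).
move=> x y; rewrite -[RHS]normcM; congr normc.
by transitivity (a * (phi x : R[i]) - a * phi y) => //; ring.
Qed.

Lemma NBVC_norm_eq0 tau (phi : NBVC tau) : NBVC_norm phi = 0 -> phi = 0.
Proof.
have [bp _ p0 pN] := NBVC_is_nbvC phi => -[tv0].
apply/val_inj/funext => x /=; have [xI|xI] := boolP (- tau <= x <= 0).
  apply: eq0_normc; apply: le_anti; rewrite -{1}tv0.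
  rewrite (normr_ge0 (nbvC_fun phi x : Rcomplex R)) andbT.
  exact: (@le_vtotal_variation R (Rcomplex R)).
exact: pN.
Qed.

HB.instance Definition _ tau := Lmodule_isNormed.Build R[i] (NBVC tau)
  (@NBVC_normD tau) (@NBVC_normZ tau) (@NBVC_norm_eq0 tau).

End ComplexNBV.


Section Complexification.
Context {R : realType} {tau : R}.

Lemma nbv_complex (phi : NBV tau) : (fun t => (phi t)%:C) \in nbvC tau.
Proof.
have [bp rp p0 pN] := NBV_is_nbv phi; apply/nbvCP; split.
- apply: (@vbounded_variation2 R R R (Rcomplex R) _ _ phi phi _ 1 0) => // x y _ _.
  rewrite mul1r mul0r addr0 -[_ - _]/((phi x)%:C - (phi y)%:C) -rmorphB.
  by rewrite /Num.norm /= expr0n /= addr0 sqrtr_sqr.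
- move=> t /rp /cvgrPdist_lt phit; apply/cvgrPdist_lt => /= e e0; move: (e : R[i]) e0 => {}e e0.
  have er : (complex.Re e)%:C = e by rewrite RRe_real // gtr0_real.
  have : 0 < complex.Re e by rewrite -ltcR er.
  move/phit; apply: filterS => x.
  by rewrite -ltcR er -rmorphB normc_def /= expr0n addr0 sqrtr_sqr.
- by rewrite p0.
- by move=> t /pN ->.
Qed.

Lemma nbv_Re (phi : NBVC tau) : (fun t => complex.Re (phi t)) \in nbv tau.
Proof.
have [bp rp p0 pN] := NBVC_is_nbvC phi; apply/nbvP; split.
- apply: (@vbounded_variation2 R (Rcomplex R) (Rcomplex R) R _ _ phi phi _ 1 0) => // x y _ _.
  rewrite mul1r mul0r addr0 -lecR -raddfB; exact: normc_ge_Re.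
- move=> t /rp /cvgrPdist_lt phit; apply/cvgrPdist_lt => e e0.
  have : 0 < e%:C by rewrite ltcR.
  move/phit; apply: filterS => x; rewrite -ltcR -raddfB.
  exact/le_lt_trans/normc_ge_Re.
- by rewrite p0.
- by move=> t /pN ->.
Qed.

Lemma normc_ge_Im (z : R[i]) : `|complex.Im z|%:C <= `|z|.
Proof.
by rewrite normc_def lecR -sqrtr_sqr ler_wsqrtr// lerDr sqr_ge0.
Qed.

Lemma nbv_Im (phi : NBVC tau) : (fun t => complex.Im (phi t)) \in nbv tau.
Proof.
have [bp rp p0 pN] := NBVC_is_nbvC phi; apply/nbvP; split.
- apply: (@vbounded_variation2 R (Rcomplex R) (Rcomplex R) R _ _ phi phi _ 1 0) => // x y _ _.
  rewrite mul1r mul0r addr0 -lecR -raddfB; exact: normc_ge_Im.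
- move=> t /rp /cvgrPdist_lt phit; apply/cvgrPdist_lt => e e0.
  have : 0 < e%:C by rewrite ltcR.
  move/phit; apply: filterS => x; rewrite -ltcR -raddfB.
  exact/le_lt_trans/normc_ge_Im.
- by rewrite p0.
- by move=> t /pN ->.
Qed.

Definition NBV_complex (phi : NBV tau) : NBVC tau := MkNBVC (nbv_complex phi).
Definition NBVC_Re (phi : NBVC tau) : NBV tau := MkNBV (nbv_Re phi).
Definition NBVC_Im (phi : NBVC tau) : NBV tau := MkNBV (nbv_Im phi).

Lemma NBVC_ReIm (phi : NBVC tau) :
  phi = NBV_complex (NBVC_Re phi) + 'i *: NBV_complex (NBVC_Im phi).
Proof. by apply/val_inj/funext => t; exact: complexE. Qed.

(* U_C (phi_Re + i phi_Im) := U phi_Re + i U phi_Im *)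
Definition complexify (U : NBV tau -> NBV tau) (phi : NBVC tau) : NBVC tau :=
  NBV_complex (U (NBVC_Re phi)) + 'i *: NBV_complex (U (NBVC_Im phi)).

End Complexification.

Section Spectrum.
Context {K : numFieldType} {V : normedModType K}.
Implicit Types (T : V -> V) (lambda : K).

Definition shifted T lambda : V -> V := fun v => T v - lambda *: v.

(* The complement of the set of lambda for which T - lambda I has a bounded
   inverse: for linear T such an S is linear, and its continuity is its
   boundedness. *)
Definition spectrum T : set K :=
  [set lambda | ~ exists S : V -> V, [/\ continuous S,
     cancel (shifted T lambda) S & cancel S (shifted T lambda)]].

Definition point_spectrum T : set K :=
  [set lambda | ~ injective (shifted T lambda)].

Definition continuous_spectrum T : set K :=
  [set lambda | [/\ injective (shifted T lambda),
     range (shifted T lambda) <> setT &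
     dense (range (shifted T lambda))]].

Definition residual_spectrum T : set K :=
  spectrum T `\` (point_spectrum T `|` continuous_spectrum T).

End Spectrum.

Section Monodromy.
Context {R : realType}.
Implicit Types (tau : R) (f x : R -> R).

Definition solves_ivp f tau (phi : NBV tau) x :=
  (forall theta : R, - tau <= theta < 0 -> x theta = phi theta) /\
  (forall t : R, 0 <= t -> x t = f t * x (t - tau)).

(* The segment of x at t, with the value at theta = 0 set to 0, and extended by
   0 outside [-tau, 0]. *)
Definition segment tau x t : R -> R :=
  fun theta => if - tau <= theta < 0 then x (t + theta) else 0.

(* By [solves_ivp_unique], [monodromy_exists] and [monodromy_unique], this
   determines a unique U when tau > 0 and f is a right-continuous function of
   bounded variation. *)
Definition is_monodromy f tau (U : NBV tau -> NBV tau) := forall phi,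
  exists2 x, solves_ivp f phi x & U phi = segment tau x tau :> (R -> R).

Definition minimal_period f tau :=
  [/\ 0 < tau, periodic f tau & forall s : R, 0 < s -> periodic f s -> tau <= s].

Lemma solves_ivp_unique f tau (phi : NBV tau) x y : 0 < tau ->
  solves_ivp f phi x -> solves_ivp f phi y ->
  forall t, - tau <= t -> x t = y t.
Proof.
move=> tau0 [x0 xS] [y0 yS] t tt.
have [n] : exists n, t < tau *+ n.
  exists (Num.truncn (t / tau)).+1; rewrite -mulr_natl -ltr_pdivrMr//.
  exact: truncnS_gt.
elim: n t tt => [|n IH] t tt.
  by rewrite mulr0n => t0; rewrite x0 ?y0 ?tt.
rewrite mulrS => tn; have [t0|t0] := ltP t 0; first by rewrite x0 ?y0 ?tt.
by rewrite xS// yS// IH//; lra.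
Qed.

Lemma solves_ivp_exists f tau (phi : NBV tau) : 0 < tau ->
  exists x, solves_ivp f phi x.
Proof.
move=> tau0; pose u := fix u n t : R :=
  if t < 0 then phi t else if n is n.+1 then f t * u n (t - tau) else 0.
have uS n t : t < tau *+ n -> u n t = u n.+1 t.
  elim: n t => [|n IH] t; first by rewrite mulr0n /= => ->.
  rewrite mulrS => tn; rewrite [LHS]/= [RHS]/=; case: ifP => // _.
  by congr (_ * _); apply: IH; lra.
have utr t : t < tau *+ (Num.truncn (t / tau)).+1.
  by rewrite -mulr_natl -ltr_pdivrMr//; exact: truncnS_gt.
have uE n m t : t < tau *+ n -> (n <= m)%N -> u m t = u n t.
  move=> tn; elim: m => [|m IH]; first by rewrite leqn0 => /eqP ->.
  rewrite leq_eqVlt => /predU1P[->//|]; rewrite ltnS => nm.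
  rewrite -IH// -uS//; apply: lt_le_trans tn _.
  by rewrite ler_pMn2l.
have u0 n t : t < 0 -> u n t = phi t by case: n => [|n] /= ->.
have uSE n t : 0 <= t -> u n.+1 t = f t * u n (t - tau).
  by move=> t0; rewrite /= ltNge t0.
clearbody u; pose x t := u (Num.truncn (t / tau)).+1 t.
exists x; split=> [t /andP[_ t0]|t t0]; first exact: u0.
rewrite {1}/x uS; last exact: utr.
rewrite uSE//; congr (_ * _); rewrite /x.
move: (utr t) (utr (t - tau)).
move: (Num.truncn (t / tau)).+1 (Num.truncn ((t - tau) / tau)).+1 => n m tn tm.
have tn' : t - tau < tau *+ n by lra.
have E1 := uE n (maxn m n) (t - tau) tn' (leq_maxr _ _).
have E2 := uE m (maxn m n) (t - tau) tm (leq_maxl _ _).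
exact: etrans (esym E1) E2.
Qed.

Lemma segment_nbv f tau (phi : NBV tau) x : 0 < tau ->
  bounded_variation 0 tau f -> right_continuous f ->
  solves_ivp f phi x -> segment tau x tau \in nbv tau.
Proof.
move=> tau0 bf rf [x0 xS]; have [bp rp p0 pN] := NBV_is_nbv phi.
have sE t : segment tau x tau t = f (tau + t) * phi t.
  rewrite /segment; case: ifPn => [tI|tI].
    have := tI => /andP[t1 t2].
    have ttE : tau + t - tau = t by ring.
    have tt0 : 0 <= tau + t by lra.
    by rewrite (xS _ tt0) ttE x0.
  have [->|t0] := eqVneq t 0; first by rewrite p0 mulr0.
  rewrite pN ?mulr0//; apply: contra tI => /andP[-> /=].
  by rewrite le_eqVlt (negPf t0).
have -> : segment tau x tau = (fun t => f (tau + t) * phi t) by exact/funext.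
have bfs : vbounded_variation (- tau) 0 (fun t => f (tau + t)).
  case: bf => M fM; exists M => _ [s [ps /eqP ls] <-]; apply: fM.
  exists (map (+%R tau) s).
    split; last by rewrite -{1}[0](addrN tau) last_map ls addr0.
    rewrite -[0](addrN tau) path_map; apply: sub_path ps => y z /=.
    by rewrite ltrD2l.
  rewrite /variation /vvariation size_map !big_nat; apply: eq_bigr => n /= ns.
  rewrite (nth_map 0)//.
  have -> : nth tau (0 :: map (+%R tau) s) n = tau + nth 0 (- tau :: s) n.
    case: n ns => [|n] ns /=; first by rewrite addrN.
    by rewrite (nth_map 0)// ltnW.
  by [].
pose M := `|f tau| + vtotal_variation (- tau) 0 (fun t => f (tau + t)).
have fM t : - tau <= t <= 0 -> `|f (tau + t)| <= M.
  move=> tI; have -> : f (tau + t) = f tau + (f (tau + t) - f tau) by ring.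
  apply: le_trans (ler_normD _ _) _; rewrite lerD2l.
  have bg : vbounded_variation (- tau) 0 (fun t => f (tau + t) - f tau).
    apply: (@vbounded_variation2 R R R R _ _ _ _ _ 1 0 _ _ _ bfs bfs) => //.
    by move=> y z _ _; rewrite mul1r mul0r addr0 opprB addrA subrK.
  apply: le_trans (le_vtotal_variation tI _ bg) _; first by rewrite addr0 subrr.
  have := @vtotal_variation2 R R R R (- tau) 0 _ _
    (fun t => f (tau + t) - f tau) 1 0 ler01 (lexx 0) _ bfs bfs.
  rewrite mul1r mul0r addr0; apply=> y z _ _.
  by rewrite mul1r mul0r addr0 opprB addrA subrK.
have M0 : 0 <= M by rewrite addr_ge0 // vtotal_variation_ge0.
apply/nbvP; split.
- apply: (@vbounded_variation2 R R R R _ _ phi (fun t => f (tau + t)) _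
    M (vtotal_variation (- tau) 0 phi)) => //; first exact: vtotal_variation_ge0.
  move=> y z yI zI.
  have -> : f (tau + y) * phi y - f (tau + z) * phi z =
    f (tau + y) * (phi y - phi z) + phi z * (f (tau + y) - f (tau + z)) by ring.
  apply: le_trans (ler_normD _ _) _; rewrite !normrM lerD// ler_wpM2r//.
    exact: fM.
  exact: (@le_vtotal_variation R R).
- move=> t tI; apply: cvgM; last exact: rp.
  have := rf (tau + t).
  move=> /cvgrPdist_lt h; apply/cvgrPdist_lt => e /h.
  rewrite !near_withinE /=.
  case=> d /= d0 hd; exists d => //= y yd ty; apply: hd => /=.
    by rewrite opprD addrACA subrr add0r.
  by rewrite ltrD2l.
- by rewrite p0 mulr0.
- by move=> t /pN ->; rewrite mulr0.
Qed.

Lemma monodromy_exists f tau : 0 < tau ->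
  bounded_variation 0 tau f -> right_continuous f ->
  exists U : NBV tau -> NBV tau, is_monodromy f U.
Proof.
move=> tau0 bf rf.
have h (phi : NBV tau) : exists psi : NBV tau,
  exists2 x, solves_ivp f phi x & psi = segment tau x tau :> (R -> R).
  have [x xS] := solves_ivp_exists f phi tau0.
  by exists (MkNBV (segment_nbv tau0 bf rf xS)), x.
by have [U UP] := choice h; exists U.
Qed.

Lemma monodromy_unique f tau (U W : NBV tau -> NBV tau) : 0 < tau ->
  is_monodromy f U -> is_monodromy f W -> U = W.
Proof.
move=> tau0 hU hW; apply/funext => phi; apply/val_inj/funext => t /=.
have [x xS ->] := hU phi; have [y yS ->] := hW phi.
rewrite /segment; case: ifP => // /andP[t1 t2].
by apply: (solves_ivp_unique tau0 xS yS); lra.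
Qed.

End Monodromy.

(* Main.v *)
(* By periodicity, U_C is multiplication by f. So lambda is an eigenvalue iff f
   equals lambda on an interval. If lambda has positive distance to f(R), then
   1 / (f - lambda) is bounded and of bounded variation, and multiplication by
   it inverts U_C - lambda. If lambda is in the closure of f(R), the range of
   U_C - lambda is not dense, so that lambda is in the residual spectrum unless
   it is an eigenvalue. *)
Require Import Defs.
From mathcomp Require Import all_boot all_order all_algebra.
From mathcomp Require Import all_classical all_reals all_analysis.
From mathcomp Require Import complex ring lra.
Import Order.TTheory GRing.Theory Num.Theory.
Import ComplexField.Normc.
Import numFieldNormedType.Exports.
Local Open Scope classical_set_scope.
Local Open Scope ring_scope.
Local Open Scope complex_scope.

(** * Moduli in [R[i]] and the supremum bound *)

Lemma normr_normc (R : realType) (z : R[i]) : `|z| = (normc z)%:C.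
Proof. by []. Qed.

Lemma normc_real (R : realType) (r : R) : normc r%:C = `|r|.
Proof. by rewrite /normc /= expr0n /= addr0 sqrtr_sqr. Qed.

Lemma cvg_complex (R : realType) (T : Type) (F : set_system T) (FF : Filter F)
    (g : T -> R) (l : R) :
  g x @[x --> F] --> l -> (g x)%:C @[x --> F] --> l%:C.
Proof.
move=> /cvgrPdist_lt gl; apply/cvgrPdist_lt => /= e e0.
(* A positive element of [R[i]] is real, so the radius [e] may be read in [R]. *)
have er : (complex.Re e)%:C = e by rewrite RRe_real // gtr0_real.
move: e0; rewrite -er ltcR => /gl; apply: filterS => x.
by rewrite -rmorphB normr_normc normc_real ltcR.
Qed.

Lemma NBVC_sup_le (R : realType) (tau : R) (phi : NBVC tau) (t : R) :
  normc (phi t) <= vtotal_variation (V := Rcomplex R) (- tau) 0 phi.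
Proof.
have [bp _ p0 pN] := NBVC_is_nbvC phi.
have [tI|/pN ->] := boolP (- tau <= t <= 0).
  exact: (@le_vtotal_variation R (Rcomplex R)).
by rewrite normc0 vtotal_variation_ge0.
Qed.

(** * Bounded multiplication operators on [NBVC tau] *)

Section Multiplication.
Context (R : realType) (tau M : R) (k : R -> R[i]).
Hypothesis M_ge0 : 0 <= M.
Hypothesis k_le : forall t, normc (k t) <= M.
Hypothesis k_bv : vbounded_variation (V := Rcomplex R) (- tau) 0 k.
Hypothesis k_rc : right_continuous k.

(** Product rule for increments. Summed over a partition, it yields both the bounded variation of
    the product and the operator bound. *)
Let mul_dist (phi : NBVC tau) (x y : R) :
  normc (k x * phi x - k y * phi y) <= M * normc (phi x - phi y) +
    vtotal_variation (V := Rcomplex R) (- tau) 0 phi * normc (k x - k y).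
Proof.
have -> : k x * phi x - k y * phi y =
  k x * (phi x - phi y) + phi y * (k x - k y) by ring.
apply: le_trans (le_normcD _ _) _; rewrite !normcM.
have n0 (z : R[i]) : 0 <= normc z by exact: (normr_ge0 (z : Rcomplex R)).
by rewrite lerD// ler_wpM2r// NBVC_sup_le.
Qed.

Lemma nbvC_mul (phi : NBVC tau) : (fun t => k t * phi t) \in nbvC tau.
Proof.
have [bp rp p0 pN] := NBVC_is_nbvC phi; apply/nbvCP; split.
- apply: (@vbounded_variation2 R (Rcomplex R) (Rcomplex R) (Rcomplex R) _ _
    phi k _ M (vtotal_variation (V := Rcomplex R) (- tau) 0 phi)) => //.
    exact: vtotal_variation_ge0.
  by move=> x y _ _; exact: mul_dist.
- by move=> t tI; apply: cvgM; [exact: k_rc|exact: rp].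
- by rewrite p0 mulr0.
- by move=> t /pN ->; rewrite mulr0.
Qed.

Definition NBVC_mul (phi : NBVC tau) : NBVC tau := MkNBVC (nbvC_mul phi).

Lemma NBVC_mul_norm_le (phi : NBVC tau) : `|NBVC_mul phi| <=
  (M + vtotal_variation (V := Rcomplex R) (- tau) 0 k)%:C * `|phi|.
Proof.
have [bp _ _ _] := NBVC_is_nbvC phi.
rewrite -[`|phi|]/((vtotal_variation (V := Rcomplex R) (- tau) 0 phi)%:C).
rewrite -rmorphM lecR mulrDl [X in _ + X]mulrC.
apply: (@vtotal_variation2 R (Rcomplex R) (Rcomplex R) (Rcomplex R)) => //.
  exact: vtotal_variation_ge0.
by move=> x y _ _; exact: mul_dist.
Qed.

Lemma continuous_NBVC_mul : continuous NBVC_mul.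
Proof.
move=> phi A /nbhs_ballP[e /= e0 eA].
(* The summand 1 keeps [C] positive, so that [e / C] is a legitimate radius. *)
pose C := M + vtotal_variation (V := Rcomplex R) (- tau) 0 k + 1.
have C0 : 0 < C%:C :> R[i].
  by rewrite ltcR ltr_wpDl// addr_ge0 // vtotal_variation_ge0.
apply/nbhs_ballP; exists (e / C%:C) => /=; first exact: divr_gt0.
move=> psi; rewrite -ball_normE /= ltr_pdivlMr// mulrC => psie.
apply: eA; rewrite -ball_normE /=; apply: le_lt_trans psie.
have -> : NBVC_mul phi - NBVC_mul psi = NBVC_mul (phi - psi).
  by apply/val_inj/funext => t /=; rewrite mulrBr.
apply: le_trans (NBVC_mul_norm_le _) _.
by rewrite ler_wpM2r// lecR lerDl.
Qed.

End Multiplication.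

(** * Step functions and translation into [-tau, 0) *)

Lemma nbvC_step (R : realType) (tau a b : R) : - tau <= a <= b -> b <= 0 ->
  (fun t : R => if a <= t < b then 1 else 0 : R[i]) \in nbvC tau.
Proof.
move=> /andP[ta ab] b0.
(* The indicator of [a, b) is the difference of those of [a, oo) and [b, oo), and each of these is
   monotone. *)
have step_bv (c : R) : vbounded_variation (- tau) 0 (fun t => (c <= t)%R%:R : R).
  apply: (@nondecreasing_bounded_variation R) => x y _ _ xy.
  by rewrite ler_nat; case: (leP c x) => // cx; rewrite (le_trans cx xy).
apply/nbvCP; split.
- apply: (@vbounded_variation2 R R R (Rcomplex R) _ _ _ _ _ 1 1 _ _ _
    (step_bv a) (step_bv b)) => // x y _ _.
  have stepE t : (if a <= t < b then 1 else 0 : R[i]) =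
      ((a <= t)%R%:R - (b <= t)%R%:R)%:C.
    have [bt|tb] := leP b t; first by rewrite (le_trans ab bt) subrr.
    by rewrite subr0 andbT; case: ifP.
  rewrite !stepE !mul1r.
  rewrite -[leLHS]/(normc (_%:C - _%:C)) -rmorphB normc_real.
  apply: le_trans (ler_normB _ _).
  by rewrite le_eqVlt; apply/orP; left; apply/eqP; congr `|_|; ring.
(* As [a, b) is closed on the left and open on the right, the step is constant just to the right of
   every [t]; the case b <= t < a contradicts a <= b. *)
- move=> t _; have [at_|ta_] := leP a t; have [bt|tb] := leP b t => /=.
  + apply: cvg_near_cst.
    near=> x.
    have bx : b <= x by apply: (le_trans bt); near: x; exact: nbhs_right_ge.
    by rewrite [x < b]ltNge bx andbF.
  + apply: cvg_near_cst.
    near=> x.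
    have -> : a <= x by apply: (le_trans at_); near: x; exact: nbhs_right_ge.
    by have -> : x < b by near: x; exact: nbhs_right_lt.
  + by move: ta_; rewrite ltNge (le_trans ab bt).
  + apply: cvg_near_cst.
    near=> x.
    by rewrite leNgt; have -> : x < a by near: x; exact: nbhs_right_lt.
- by rewrite ltNge b0 andbF.
- move=> t; rewrite negb_and -!ltNge => /orP[t1|t1].
    by rewrite leNgt (lt_le_trans t1 ta).
  by rewrite [_ < b]ltNge (le_trans b0 (ltW t1)) andbF.
Unshelve. all: by end_near. Qed.

Lemma periodicZ (R : realType) (tau : R) (f : R -> R) (n : int) (t : R) :
  periodic f tau -> f (t + tau *~ n) = f t.
Proof.
move=> fp; case: n => n; first exact: (periodicn fp).
by rewrite NegzE mulrNz -(periodicn fp n.+1) subrK.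
Qed.

Lemma shift_fundamental (R : realType) (tau t : R) : 0 < tau ->
  exists n : int, - tau <= t + tau *~ n < 0.
Proof.
(* Subtracting the floor alone would land in [0, tau); the extra 1 moves one period further left. *)
move=> tau0; exists (- (Num.floor (t / tau) + 1)).
have /andP[] := floor_itv (t / tau).
rewrite mulrNz -mulrzr ler_pdivlMr// ltr_pdivrMr// intrD; lra.
Qed.

(** * Spectrum of multiplication by a periodic function *)

Section MultiplicationSpectrum.
Context (R : realType) (tau : R) (f : R -> R) (T : NBVC tau -> NBVC tau).
Hypothesis tau_gt0 : 0 < tau.
Hypothesis f_bv : bounded_variation (- tau) 0 f.
Hypothesis f_rc : right_continuous f.
Hypothesis f_per : periodic f tau.
Hypothesis T_mul : forall phi t, T phi t = (f t)%:C * phi t.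

Let shiftedE lambda phi t :
  shifted T lambda phi t = ((f t)%:C - lambda) * phi t.
Proof.
transitivity (T phi t - lambda * phi t) => //.
by rewrite T_mul mulrBl.
Qed.

(** A kernel element that is nonzero at a point stays nonzero just to its right, which forces f =
    lambda there. Conversely, a step function supported where f = lambda lies in the kernel. *)
Lemma multiplication_point_spectrum : point_spectrum T =
  [set lambda : R[i] | interior [set t : R | (f t)%:C = lambda] !=set0].
Proof.
apply/seteqP; split=> lambda /=.
  move=> ninj; apply: contrapT => int0; apply: ninj => phi psi /(congr1 val).
  move=> eq_pp; apply/eqP; rewrite -subr_eq0; apply/eqP.
  have : forall t, ((f t)%:C - lambda) * (phi - psi) t = 0.
    move=> t; rewrite -[(phi - psi) t]/(phi t - psi t) mulrBr -!shiftedE.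
    by rewrite -[nbvC_fun (shifted T lambda phi)]/(val _) eq_pp subrr.
  move: (phi - psi) => {eq_pp psi}phi phi0.
  have [_ rp p0 pN] := NBVC_is_nbvC phi.
  apply/val_inj/funext => t /=; apply: contrapT => /eqP phit0.
  apply: int0.
  have tI : - tau <= t < 0.
    have /andP[-> t0] : - tau <= t <= 0.
      by apply: contraNT phit0 => /pN ->.
    by rewrite lt_neqAle t0 andbT; apply: contraNneq phit0 => ->; rewrite p0.
  have : \forall x \near t^'+, phi x != 0.
    have : 0 < `|phi t| by rewrite normr_gt0.
    move: (rp _ tI) => /cvgr_dist_lt /[apply]; apply: filterS => x.
    by apply: contraTneq => ->; rewrite subr0 ltxx.
  rewrite near_withinE => -[/= d d0 near_d].
  (* The ball of radius d / 2 about this point is (t, t + d), where [phi] has no zero. *)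
  exists (t + d / 2); rewrite /interior /=.
  apply/nbhs_ballP; exists (d / 2) => /=; first lra.
  move=> x; rewrite /ball /= => xd.
  have tx : t < x by move: xd; rewrite ltr_norml; lra.
  have /eqP : ((f x)%:C - lambda) * phi x = 0 by exact: phi0.
  rewrite mulf_eq0 subr_eq0 => /orP[/eqP//|].
  apply: contraTeq => _; apply: near_d => //=.
  by move: xd; rewrite ltr_norml [in X in _ -> X]distrC ger0_norm; lra.
move=> -[t0 /nbhs_ballP[e /= e0 flam]] inj.
have [n] := shift_fundamental _ tau t0 tau_gt0.
set t := t0 + tau *~ n => /andP[t1 t2].
(* The cut at 0 keeps the step inside [-tau, 0); the cut at t + e / 2 keeps its support, translated
   back by n periods, inside the ball where f = lambda. *)
pose b := Num.min (t + e / 2) 0.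
have tb : t < b by rewrite lt_min t2 andbT; lra.
have b0 : b <= 0 by rewrite ge_min lexx orbT.
have be : b <= t + e / 2 by rewrite ge_min lexx.
have tI : - tau <= t <= b by rewrite t1 ltW.
pose phi := MkNBVC (nbvC_step R tau t b tI b0).
have : phi = 0.
  apply: inj.
  suff eq_phi x : shifted T lambda phi x = shifted T lambda 0 x.
    exact/val_inj/funext.
  rewrite !shiftedE /= mulr0.
  case: ifP => [/andP[tx xb]|]; last by rewrite mulr0.
  rewrite -(flam (x - tau *~ n)).
    by rewrite -mulrNz periodicZ// subrr mul0r.
  by rewrite /ball /= ltr_norml; rewrite /t in tx be; lra.
move=> /(congr1 (fun p : NBVC tau => p t)) /=; rewrite lexx tb /=.
by apply/eqP; exact: oner_neq0.
Qed.

(* The range stays at distance at least 1 from the function equal to 1 on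
   [-tau, 0): the total variation norm dominates the supremum norm, and
   (f - lambda) * phi takes arbitrarily small values because phi is bounded. *)
Lemma multiplication_range_not_dense lambda :
  closure [set (f t)%:C | t in [set: R]] lambda ->
  ~ dense (range (shifted T lambda)).
Proof.
move=> clf dT.
have tI : - tau <= - tau <= 0 by rewrite lexx /= oppr_le0 ltW.
pose one := MkNBVC (nbvC_step R tau (- tau) 0 tI (lexx 0)).
have [|y [near1 [phi _ phiE]]] := dT (ball one 1) _ (ball_open _ _).
  by exists one; exact: ballxx.
move: near1; rewrite -{y}phiE => near1.
pose M := vtotal_variation (V := Rcomplex R) (- tau) 0 phi.
pose D := vtotal_variation (V := Rcomplex R) (- tau) 0 (one - shifted T lambda phi).
have D1 : D < 1.
  by move: near1; rewrite -ball_normE /= -ltcR.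
have M0 : 0 <= M by exact: vtotal_variation_ge0.
(* If f is this close to lambda at a point, then |(f - lambda) phi| < 1 - D there; M + 1 avoids
   division by zero. *)
have e0 : 0 < (1 - D) / (M + 1) by rewrite divr_gt0// ?subr_gt0// ltr_wpDl.
have /nbhs_ballP : nbhs_ball lambda (ball lambda ((1 - D) / (M + 1))%:C).
  by exists ((1 - D) / (M + 1))%:C => //=; rewrite ltcR.
move=> /clf[_ [[s _ <-]]]; rewrite -ball_normE /= distrC normr_normc ltcR => fs.
(* Periodicity moves the point into [-tau, 0), where [one] takes the value 1. *)
have [n] := shift_fundamental _ tau s tau_gt0.
rewrite -(periodicZ _ tau f n s) // in fs.
move: (s + _) fs => t fs tI'.
have := NBVC_sup_le _ _ (one - shifted T lambda phi) t.
have -> : (one - shifted T lambda phi) t = 1 - ((f t)%:C - lambda) * phi t.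
  rewrite -shiftedE; transitivity (one t - shifted T lambda phi t) => //.
  by rewrite /= tI'.
rewrite -/D.
apply/negP; rewrite -ltNge.
have h : normc (((f t)%:C - lambda) * phi t) < 1 - D.
  rewrite normcM; move: fs; rewrite ltr_pdivlMr; last by rewrite ltr_wpDl.
  move=> fs.
  apply: le_lt_trans fs; apply: ler_wpM2l.
    exact: (normr_ge0 (_ : Rcomplex R)).
  by apply: le_trans (NBVC_sup_le _ _ _ _) _; rewrite lerDl.
(* By the triangle inequality, [one - shifted T lambda phi] has modulus greater than D at [t],
   against the supremum bound. *)
have := le_normcD (1 - ((f t)%:C - lambda) * phi t) (((f t)%:C - lambda) * phi t).
by rewrite subrK normc1; lra.
Qed.

Lemma multiplication_spectrum_sub :
  spectrum T `<=` closure [set (f t)%:C | t in [set: R]].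
Proof.
move=> lambda; apply: contraPP => /existsNP[B /not_implyP[]].
move=> /nbhs_ballP[d' /= d'0 dB] fB spec.
(* A ball about lambda that misses f(R) gives the uniform lower bound; its radius is positive in
   [R[i]], hence real. *)
have [d d0 d_le] : exists2 d : R, 0 < d & forall t, d <= normc ((f t)%:C - lambda).
  have er : (complex.Re d')%:C = d' by rewrite RRe_real // gtr0_real.
  exists (complex.Re d'); first by rewrite -ltcR er.
  move=> t; rewrite leNgt; apply/negP => ft; apply: fB; exists (f t)%:C.
  split; first by exists t.
  by apply: dB; rewrite -ball_normE /= distrC normr_normc -er ltcR.
have fl0 t : (f t)%:C - lambda != 0.
  by apply/eqP => ft; have := d_le t; rewrite ft normc0; lra.
have di0 : 0 <= d^-1 by rewrite invr_ge0 ltW.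
pose k t := ((f t)%:C - lambda)^-1.
have kM t : normc (k t) <= d^-1.
  by rewrite normcV lef_pV2 ?posrE// (lt_le_trans d0).
have k_bv : vbounded_variation (V := Rcomplex R) (- tau) 0 k.
  apply: (@vbounded_variation2 R R R (Rcomplex R) _ _ f f _ (d^-1 * d^-1) 0) => //.
    by rewrite mulr_ge0.
  move=> x y _ _; rewrite mul0r addr0.
  (* This identity bounds the increments of [k] by d^-2 times those of f. *)
  have -> : k x - k y = k x * k y * (f y - f x)%:C.
    by rewrite /k rmorphB; field; rewrite !fl0.
  rewrite -[leLHS]/(normc _) !normcM normc_real distrC ler_wpM2r//.
  by apply: ler_pM => //; exact: (normr_ge0 (_ : Rcomplex R)).
have k_rc : right_continuous k.
  move=> t; apply: cvgV => //; apply: cvgB; last exact: cvg_cst.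
  exact: cvg_complex.
apply: spec; exists (NBVC_mul R tau d^-1 k di0 kM k_bv k_rc); split.
- exact: continuous_NBVC_mul.
- move=> phi; apply/val_inj/funext => t.
  rewrite -[LHS]/(k t * shifted T lambda phi t) shiftedE; exact: mulKf.
- move=> phi; apply/val_inj/funext => t.
  by apply: etrans (shiftedE _ _ _) _; exact: mulVKf.
Qed.

Lemma multiplication_residual_spectrum : residual_spectrum T =
  closure [set (f t)%:C | t in [set: R]] `\`
  [set lambda : R[i] | interior [set t : R | (f t)%:C = lambda] !=set0].
Proof.
rewrite -multiplication_point_spectrum; apply/seteqP; split=> lambda.
  by move=> [/multiplication_spectrum_sub cl /not_orP[]].
move=> [cl npt]; have ndense := multiplication_range_not_dense _ cl.
split; last by move=> [//|[_ _ /ndense]].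
(* A right inverse would make the range the whole space, hence dense; so lambda belongs to the
   spectrum. *)
move=> [S [_ _ TS]]; apply: ndense => O [psi Opsi] _; exists psi; split => //.
by exists (S psi).
Qed.

End MultiplicationSpectrum.

(** * The monodromy operator as a multiplication operator *)

Lemma monodromyE (R : realType) (tau : R) (f : R -> R)
    (U : NBV tau -> NBV tau) (phi : NBV tau) (t : R) :
  is_monodromy f U -> U phi t = f (t + tau) * phi t.
Proof.
move=> hU; have [x [x0 xS] ->] := hU phi; have [_ _ p0 pN] := NBV_is_nbv phi.
rewrite /segment; case: ifPn => [tI|tI].
  (* For t in [-tau, 0) the delay equation at time tau + t refers back to the initial segment at
     [t], so one application suffices. *)
  rewrite xS; last by lra.
  by rewrite [tau + t]addrC addrK x0.
have [->|t0] := eqVneq t 0; first by rewrite p0 mulr0.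
rewrite pN ?mulr0//; apply: contra tI => /andP[-> /=].
by rewrite le_eqVlt (negPf t0).
Qed.

(** Multiplication by a real function acts separately on real and imaginary parts. *)
Lemma complexify_monodromyE (R : realType) (tau : R) (f : R -> R)
    (U : NBV tau -> NBV tau) (phi : NBVC tau) (t : R) :
  is_monodromy f U -> complexify U phi t = (f (t + tau))%:C * phi t.
Proof.
move=> hU; rewrite [in RHS](NBVC_ReIm phi) /complexify !NBVC_addE !NBVC_scaleE /=.
by rewrite !(monodromyE _ _ _ _ _ _ hU) !rmorphM /=; ring.
Qed.

Theorem corollary7 (R : realType) (tau : R) (f : R -> R)
    (tau_gt0 : 0 < tau)
    (f_bv : forall a b : R, a <= b -> bounded_variation a b f)
    (f_rc : right_continuous f)
    (f_per : (exists c : R, forall t : R, f t = c) \/ minimal_period f tau)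
    (U : NBV tau -> NBV tau) (U_monodromy : is_monodromy f U) :
  residual_spectrum (complexify U) =
    closure [set (f t)%:C | t in [set: R]] `\`
    [set lambda : R[i] |
      interior [set t : R | (f t)%:C = lambda] !=set0].
Proof.
(* A constant has every period, so both cases supply the period [tau], which turns f (t + tau) into
   f t. *)
have per : periodic f tau.
  by case: f_per => [[c fc] t|[]//]; rewrite !fc.
apply: multiplication_residual_spectrum => //.
  by apply: f_bv; rewrite oppr_le0 ltW.
by move=> phi t; rewrite (complexify_monodromyE _ _ f)// per.
Qed.
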